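(* For every $\varepsilon>0$ there exists $C\in\mathbb{R}$ such that, with high probability (i.e. with probability tending to $1$ as $n\to\infty$), the random graph $G\sim G(n,C/n)$ has the following property: there exists a subset $V'\subseteq[n]$ of size $|V'|\ge(1-\varepsilon)n$ for which the induced subgraph $G[V']$ is globally rigid in $\mathbb{R}$.
   Context: $G(n,p)$ is the Erdős–Rényi random graph on the vertex set $[n]=\{1,\dots,n\}$, in which each pair of vertices is an edge independently with probability $p$. Global rigidity in $\mathbb{R}$ (injective version): a simple graph $H=(V,E)$ is globally rigid in $\mathbb{R}$ if for every two injective functions $f,g:V\to\mathbb{R}$ satisfying $|f(x)-f(y)|=|g(x)-g(y)|$ for every edge $xy\in E$, we also have $|f(x)-f(y)|=|g(x)-g(y)|$ for every pair $x,y\in V$. *)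

(* Defs.v *)
From HB Require Import structures.
From mathcomp Require Import all_boot all_order all_algebra.
From mathcomp Require Import all_classical all_reals all_analysis.

Set Implicit Arguments.
Unset Strict Implicit.
Unset Printing Implicit Defensive.

Import Order.TTheory GRing.Theory Num.Theory.
Import numFieldNormedType.Exports.
Local Open Scope ring_scope.

(* A simple graph is its set of edges, an edge being an unordered pair of
   distinct vertices. *)
Record sgraph (T : finType) := SGraph {
  edges :> {set {set T}};
  edges_card2 : [forall e in edges, #|e| == 2%N] }.

HB.instance Definition _ (T : finType) := [isSub for @edges T].
HB.instance Definition _ (T : finType) := [Finite of sgraph T by <:].

Definition adj (T : finType) (G : sgraph T) (x y : T) : bool :=
  [set x; y]%SET \in edges G.

Definition induced_edges (T : finType) (G : sgraph T) (V : {set T}) :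
    {set {set {x : T | x \in V}}} :=
  [set e : {set {x : T | x \in V}} | val @: e \in edges G]%SET.

Lemma induced_card2 (T : finType) (G : sgraph T) (V : {set T}) :
  [forall e in induced_edges G V, #|e| == 2%N].
Proof.
apply/forall_inP => e; rewrite inE => eG.
by rewrite -(card_imset _ val_inj); exact: (forall_inP (edges_card2 G)).
Qed.

Definition induced_subgraph (T : finType) (G : sgraph T) (V : {set T}) :
    sgraph {x : T | x \in V} :=
  SGraph (induced_card2 G V).

Definition globally_rigid (R : realType) (T : finType) (H : sgraph T) : Prop :=
  forall f g : T -> R, injective f -> injective g ->
    (forall x y, adj H x y -> `|f x - f y| = `|g x - g y|) ->
    forall x y, `|f x - f y| = `|g x - g y|.

(* The probability that G(n, p) equals G: each of the pairs of vertices is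
   an edge with probability p, independently. It is a probability mass
   function only for 0 <= p <= 1. *)
Definition gnp_mass (R : realType) (n : nat) (p : R) (G : sgraph 'I_n) : R :=
  \prod_(e : {set 'I_n} | #|e| == 2%N) (if e \in edges G then p else 1 - p).

Definition gnp_prob (R : realType) (n : nat) (p : R) (A : set (sgraph 'I_n)) :
    R :=
  \sum_(G : sgraph 'I_n | G \in A) gnp_mass p G.

(* Main.v *)
(* For a small constant d and C large, a union bound shows that whp G(n, C/n)
   has an edge between any two disjoint sets of m = d n vertices (it is
   "m-joined"), and the rest is deterministic. If |f x - f y| = |g x - g y| on
   the edges, then each edge preserves a = f - g or b = f + g. Splitting V at
   a value of a and at a value of b gives four quarters with no edge between
   opposite ones, so in an m-joined graph one of the two cuts is unbalanced,
   whence some level set of a or of b, say {a = t}, contains all but 4m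
   vertices. A vertex w outside it has at most one neighbour in it, since such
   neighbours share both a and b = b w. Thus the exceptional set W is "loose":
   each of its vertices has at most one neighbour outside W. Deleting a maximal
   loose set of fewer than 2m vertices beforehand forces W to be empty. *)
Require Import Defs.
From mathcomp Require Import all_boot all_order all_algebra.
From mathcomp Require Import all_classical all_reals all_analysis.
From mathcomp Require Import zify lra.
Import Order.TTheory GRing.Theory Num.Theory.
Import numFieldNormedType.Exports.
Local Open Scope classical_set_scope.
Local Open Scope ring_scope.

(** * Joined graphs and loose sets *)

Section Combinatorics.
Local Open Scope set_scope.
Local Open Scope nat_scope.

Definition joined {T : finType} (G : sgraph T) (m : nat) : bool :=
  [forall X : {set T}, forall Y : {set T},
    [&& m <= #|X|, m <= #|Y| & [disjoint X & Y]] ==>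
    [exists x in X, exists y in Y, adj G x y]].

Lemma joinedP {T : finType} {G : sgraph T} {m : nat} :
  reflect (forall X Y : {set T}, m <= #|X| -> m <= #|Y| -> [disjoint X & Y]%B ->
             exists x y, [/\ x \in X, y \in Y & adj G x y])
          (joined G m).
Proof.
apply: (iffP idP) => [joinG X Y mX mY dXY | joinG].
  have /forallP/(_ X)/forallP/(_ Y) := joinG; rewrite mX mY dXY /=.
  by case/exists_inP => x xX /exists_inP[y yY xy]; exists x, y.
apply/forallP => X; apply/forallP => Y; apply/implyP => /and3P[mX mY dXY].
have [x [y [xX yY xy]]] := joinG _ _ mX mY dXY.
by apply/exists_inP; exists x => //; apply/exists_inP; exists y.
Qed.

Lemma adj_induced {T : finType} {G : sgraph T} (V : {set T})
    (x y : {x : T | x \in V}) :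
  adj (induced_subgraph G V) x y = adj G (val x) (val y).
Proof. by rewrite /adj /= inE imsetU1 imset_set1. Qed.

Lemma joined_induced {T : finType} {G : sgraph T} {m : nat} (V : {set T}) :
  joined G m -> joined (induced_subgraph G V) m.
Proof.
move=> /joinedP joinG; apply/joinedP => X Y mX mY dXY.
have [|||] := joinG (val @: X) (val @: Y).
- by rewrite card_imset //; exact: val_inj.
- by rewrite card_imset //; exact: val_inj.
- by rewrite imset_disjoint //; exact: val_inj.
move=> _ [_ [/imsetP[x xX ->] /imsetP[y yY ->] xy]].
by exists x, y; rewrite adj_induced.
Qed.

Definition nbrs {T : finType} (G : sgraph T) (x : T) : {set T} :=
  [set y | adj G x y].

Definition loose {T : finType} (G : sgraph T) (U : {set T}) : bool :=
  [forall u in U, #|nbrs G u :\: U| <= 1].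

(* Split the complement of [U] into two halves: fewer than [m] vertices of [U]
   have no neighbour in a given half, and the others see both halves. *)
Lemma card_loose {T : finType} {G : sgraph T} {m : nat} {U : {set T}} :
  joined G m -> loose G U -> #|U| + m.*2 <= #|T| -> #|U| < m.*2.
Proof.
move=> /joinedP joinG /forall_inP looseU leT; rewrite ltnNge; apply/negP => leU.
have cU := cardsC U.
have [s [s_uniq s_size sU]] : exists s, [/\ uniq s, size s = m &
    {subset s <= ~: U}] by apply/card_geqP; lia.
pose Y1 := [set x in s]; pose Y2 := ~: U :\: Y1.
have Y1U : Y1 \subset ~: U.
  by apply/fintype.subsetP => x; rewrite inE; exact: sU.
have cY1 : #|Y1| = m by rewrite cardsE -s_size; exact/card_uniqP.
have cY2 : m <= #|Y2|.
  by have := cardsD (~: U) Y1; rewrite (finset.setIidPr Y1U) /Y2; lia.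
pose Z (Y : {set T}) := [set u in U | [disjoint nbrs G u & Y]].
have cZ (Y : {set T}) : m <= #|Y| -> Y \subset ~: U -> #|Z Y| < m.
  move=> mY YU; rewrite ltnNge; apply/negP => mZ.
  have [|x [y [xZ yY xy]]] := joinG _ _ mZ mY.
    apply/pred0P => x /=; rewrite inE; apply/negP => /andP[/andP[xU _]].
    by move/(fintype.subsetP YU); rewrite inE xU.
  move: xZ; rewrite inE => /andP[_ /pred0P/(_ y)/=].
  by rewrite inE xy yY.
have cZ1 := cZ _ (eq_leq (esym cY1)) Y1U.
have cZ2 := cZ _ cY2 (finset.subsetDl _ _).
have /fintype.subsetPn[u uU] : ~~ (U \subset Z Y1 :|: Z Y2).
  apply/negP => /subset_leq_card; have [] := leq_card_setU (Z Y1) (Z Y2).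
  lia.
rewrite !inE uU /= negb_or => /andP[/pred0Pn[y1 /=] + /pred0Pn[y2 /=]].
move=> /andP[uy1 yY1] /andP[uy2 yY2].
have := looseU u uU; rewrite leqNgt => /negP; apply.
apply/card_gt1P; exists y1, y2; split.
- by have := fintype.subsetP Y1U _ yY1; rewrite inE => y1U; rewrite inE y1U.
- by move: yY2; rewrite inE => /andP[_]; rewrite inE => y2U; rewrite inE y2U.
by apply: contraTneq yY2 => <-; rewrite inE yY1.
Qed.

(* The vertex set is what remains after deleting a maximal loose set: a loose
   set of the remainder could be added to the deleted one. *)
Lemma joined_core {T : finType} {G : sgraph T} {m : nat} :
  joined G m -> m * 8 <= #|T| ->
  exists2 V : {set T}, #|T| <= #|V| + m.*2 &
    forall W : {set {x : T | x \in V}},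
      loose (induced_subgraph G V) W -> #|W| <= m * 4 -> W = finset.set0.
Proof.
move=> joinG leT.
(* The size bound is the one [card_loose] asks for, so a maximal [U] has fewer than [2m] vertices.
   Adding a [W] of at most [4m] vertices then still leaves [2m] outside, as [2m + 4m + 2m = 8m]. *)
pose P (U : {set T}) := loose G U && (#|U| + m.*2 <= #|T|).
have P0 : P finset.set0.
  by apply/andP; split; [apply/forall_inP => u; rewrite inE|rewrite cards0; lia].
case: (arg_maxnP (fun U : {set T} => #|U|) P0) => U /andP[looseU cU] maxU.
have ltU := card_loose joinG looseU cU.
exists (~: U) => [|W looseW cW]; first by have := cardsC U; lia.
apply/eqP; rewrite -cards_eq0; apply/negPn/negP => W0.
have cvW : #|val @: W| = #|W| by rewrite card_imset //; exact: val_inj.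
have dUW : U :&: val @: W = finset.set0.
  apply/finset.setP => x; rewrite !inE; apply/negP => /andP[xU /imsetP[y _ xy]].
  by have := valP y; rewrite inE -xy xU.
have cUW : #|U :|: val @: W| = #|U| + #|W|.
  by rewrite cardsU dUW cards0 subn0 cvW.
have /maxU : P (U :|: val @: W); last by rewrite /= cUW; lia.
apply/andP; split; last by rewrite cUW; lia.
(* A vertex of [U] only loses outside neighbours when [U] grows; those of a vertex of [W] all lie in
   the induced subgraph, outside [W]. *)
apply/forall_inP => u; rewrite !inE => /orP[uU | /imsetP[w wW ->]].
  apply: leq_trans (forall_inP looseU u uU); apply: subset_leq_card.
  by apply: finset.setDS; exact: finset.subsetUl.
apply: leq_trans (forall_inP looseW w wW).
rewrite -(card_imset _ val_inj); apply: subset_leq_card.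
apply/fintype.subsetP => x; rewrite !inE negb_or => /andP[/andP[xU xW] wx].
have xV : x \in ~: U by rewrite inE.
apply/imsetP; exists (exist _ x xV : {x : T | x \in ~: U}) => //.
rewrite !inE adj_induced wx andbT.
by apply: contra xW => /imset_f - /(_ _ val).
Qed.

(** An edge between opposite quarters would cross both cuts, so each of the two opposite pairs
    contains a quarter with fewer than [m] vertices. Two such quarters, one from each pair, together
    form a side of one of the cuts. *)
Lemma joined_cuts {T : finType} {G : sgraph T} {m : nat} {S S' : {set T}} :
  joined G m ->
  (forall x y, adj G x y -> (x \in S) = (y \in S) \/ (x \in S') = (y \in S')) ->
  [|| #|S| < m.*2, #|~: S| < m.*2, #|S'| < m.*2 | #|~: S'| < m.*2].
Proof.
move=> /joinedP joinG cutG.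
have small (A B : {set T}) :
    (forall x y, x \in A -> y \in B ->
       (x \in S) != (y \in S) /\ (x \in S') != (y \in S')) ->
    #|A| < m \/ #|B| < m.
  move=> AB; case: (ltnP #|A| m) => [|mA]; first by left.
  case: (ltnP #|B| m) => [|mB]; first by right.
  have [|x [y [xA yB xy]]] := joinG _ _ mA mB.
    apply/pred0P => x /=; apply/negP => /andP[xA xB].
    by have [] := AB x x xA xB; rewrite eqxx.
  by have [/eqP ? /eqP ?] := AB x y xA yB; case: (cutG x y xy).
have h1 : #|S :&: S'| < m \/ #|~: S :\: S'| < m.
  by apply: small => x y; rewrite !inE;
    case: (x \in S); case: (x \in S'); case: (y \in S); case: (y \in S').
have h2 : #|S :\: S'| < m \/ #|~: S :&: S'| < m.
  by apply: small => x y; rewrite !inE;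
    case: (x \in S); case: (x \in S'); case: (y \in S); case: (y \in S').
have := cardsID S' S; have := cardsID S' (~: S).
have := cardsID S S'; have := cardsID S (~: S').
rewrite ![_ :&: S]finset.setIC -!finset.setDE.
have -> : S' :\: S = ~: S :&: S' by rewrite finset.setDE finset.setIC.
have -> : ~: S' :\: S = ~: S :\: S' by rewrite !finset.setDE finset.setIC.
case: h1 h2 => h1 [] h2; lia.
Qed.

End Combinatorics.

(** * From joined graphs to global rigidity *)

Section Rigidity.
Local Open Scope set_scope.

(** Cut at the least value of [a] with at least [k] vertices at or below it. If fewer than [k]
    vertices lie above, then fewer than [k] lie on either side of this level. *)
Lemma cut_or_level {R : realType} {T : finType} (a : T -> R) {k : nat} :
  (0 < k <= #|T|)%N ->
  (exists t, k <= #|[set x | (a x <= t)%R]| /\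
             k <= #|~: [set x | (a x <= t)%R]|)%N \/
  (exists t, #|[set x | a x != t]| < k.*2)%N.
Proof.
case/andP=> k0 kT.
have [x0 _] : exists x0 : T, x0 \in T by apply/card_gt0P; exact: leq_trans kT.
case: (@Order.TotalTheory.arg_maxP _ _ _ x0 predT a isT) => x1 _ x1max.
have Px1 : (k <= #|[set y | (a y <= a x1)%R]|)%N.
  apply: leq_trans kT _; apply/subset_leq_card/fintype.subsetP => y _.
  by rewrite inE; exact: x1max.
case: (@Order.TotalTheory.arg_minP _ _ _ x1
  (fun x => k <= #|[set y | (a y <= a x)%R]|)%N a Px1) => x kx xmin.
(* Otherwise the largest value below [a x] would contradict the minimality of [a x]. *)
have ltx : (#|[set y | (a y < a x)%R]| < k)%N.
  rewrite ltnNge; apply/negP => kle.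
  have [z0] : exists z, z \in [set y | a y < a x].
    by apply/card_gt0P; exact: leq_trans kle.
  rewrite inE => z0x.
  case: (@Order.TotalTheory.arg_maxP _ _ _ z0 (fun y => a y < a x) a z0x).
  move=> z zx zmax.
  have /xmin : (k <= #|[set y | (a y <= a z)%R]|)%N.
    apply: leq_trans kle _; apply/subset_leq_card/fintype.subsetP => y.
    by rewrite !inE; exact: zmax.
  by rewrite leNgt zx.
have [kgt|gtk] := leqP k #|~: [set y | (a y <= a x)%R]|.
  by left; exists (a x).
right; exists (a x).
have -> : [set y | a y != a x] =
    [set y | a y < a x] :|: ~: [set y | a y <= a x].
  by apply/finset.setP => y; rewrite !inE -ltNge neq_lt.
have [+ _] := leq_card_setU [set y | a y < a x] (~: [set y | a y <= a x]).
lia.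
Qed.

(** The hypotheses relating [a] and [b] are symmetric, so the lemma also serves with the two
    exchanged. *)
Lemma level_of_loose {R : realType} {T : finType} {G : sgraph T} {m : nat}
    {a b : T -> R} :
  (forall W, loose G W -> (#|W| <= m * 4)%N -> W = finset.set0) ->
  (forall x y, a x = a y -> b x = b y -> x = y) ->
  (forall x y, adj G x y -> a x = a y \/ b x = b y) ->
  (exists t, #|[set x | a x != t]| < m.*2.*2)%N ->
  forall x y, a x = a y.
Proof.
move=> core ab_inj ab_adj [t mt] x y.
have /core W0 : loose G [set x | a x != t].
  apply/forall_inP => w; rewrite inE => aw; rewrite leqNgt.
  apply/negP => /card_gt1P[u [v []]]; rewrite !inE !negbK.
  move=> /andP[/eqP au wu] /andP[/eqP av wv] /eqP; apply.
  case: (ab_adj _ _ wu) => [wau|wbu]; first by move: aw; rewrite wau au eqxx.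
  case: (ab_adj _ _ wv) => [wav|wbv]; first by move: aw; rewrite wav av eqxx.
  by apply: ab_inj; rewrite ?au ?av // -wbu.
have at_ z : a z = t.
  apply/eqP/negPn/negP => az; have : z \in [set x | a x != t] by rewrite inE.
  by rewrite W0 ?inE //; lia.
by rewrite !at_.
Qed.

(* With [a := f - g] and [b := f + g], each edge lies on a level of [a] or of
   [b], and [f], [g] are congruent exactly when [a] or [b] is constant. *)
Lemma joined_rigid (R : realType) {T : finType} {G : sgraph T} {m : nat} :
  joined G m -> (m * 4 <= #|T|)%N ->
  (forall W, loose G W -> (#|W| <= m * 4)%N -> W = finset.set0) ->
  globally_rigid R G.
Proof.
move=> joinG mT core f g f_inj g_inj fg_adj.
(* No graph is [0]-joined: the empty set would have to contain an endpoint. *)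
have [m0|m0] := posnP m.
  have /joinedP joinG0 := joinG.
  have [|||x [y []]] := joinG0 finset.set0 finset.set0; rewrite ?m0 //.
    by rewrite -finset.setI_eq0 finset.set0I.
  by rewrite inE.
pose a x := f x - g x; pose b x := f x + g x.
have abE x y : `|f x - f y| = `|g x - g y| <-> a x = a y \/ b x = b y.
  split=> [/eqP|]; rewrite /a /b.
    by rewrite eqr_norm2 => /orP[/eqP ?|/eqP ?]; [left|right]; lra.
  by move=> h; apply/eqP; rewrite eqr_norm2; apply/orP;
    case: h => h; [left|right]; apply/eqP; lra.
have ab_adj x y : adj G x y -> a x = a y \/ b x = b y.
  by move=> /fg_adj; rewrite abE.
have ab_inj x y : a x = a y -> b x = b y -> x = y.
  by rewrite /a /b => ? ?; apply: f_inj; lra.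
(* With threshold [2m], a level misses fewer than [4m] vertices, as [core] requires, while balanced
   cuts for both [a] and [b] contradict [joined_cuts]. *)
have mT2 : (0 < m.*2 <= #|T|)%N by lia.
move=> x y; apply/abE.
case: (cut_or_level a mT2) => [[s [s1 s2]]|at_]; last first.
  by left; apply: (level_of_loose core ab_inj ab_adj at_).
case: (cut_or_level b mT2) => [[t [t1 t2]]|bt]; last first.
  right; apply: (@level_of_loose _ _ _ _ b a core _ _ bt) => u v.
    by move=> ? ?; exact: ab_inj.
  by move=> /ab_adj; tauto.
have := @joined_cuts T G m [set x | a x <= s] [set x | b x <= t] joinG.
rewrite !ltnNge s1 s2 t1 t2 => cutG; suff: false by []; apply: cutG => u v.
by move=> /ab_adj[] uv; rewrite !inE uv; [left|right].
Qed.

Lemma joined_rigid_subgraph (R : realType) {T : finType} {G : sgraph T}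
    {m : nat} :
  joined G m -> (m * 8 <= #|T|)%N ->
  exists2 V : {set T}, (#|T| <= #|V| + m.*2)%N &
    globally_rigid R (induced_subgraph G V).
Proof.
move=> joinG mT; have [V cV core] := joined_core joinG mT.
exists V => //; apply: (joined_rigid R (joined_induced V joinG)) => //.
have -> : #|{: {x : T | x \in V}}| = #|V| by rewrite card_sig; exact: eq_card.
lia.
Qed.

End Rigidity.

(** * Probability that a random graph is joined *)

Lemma sum_sgraph {R : realType} {T : finType} (u v : {set T} -> R) :
  \sum_(G : sgraph T)
     \prod_(e : {set T} | #|e| == 2%N) (if e \in edges G then u e else v e) =
  \prod_(e : {set T} | #|e| == 2%N) (u e + v e).
Proof.
(* With the weights extended to all subsets, the distributive law sums over all families of sets; a
   family with a member of size other than 2 contributes 0, and the others are the graphs. *)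
pose w (e : {set T}) := if #|e| == 2%N then u e else 0.
pose w' (e : {set T}) := if #|e| == 2%N then v e else 1.
transitivity (\prod_(e : {set T}) (w e + w' e)); last first.
  rewrite [RHS]big_mkcond; apply: eq_bigr => e _.
  by rewrite /w /w'; case: ifP => // _; rewrite add0r.
rewrite (bigA_distr _ _ w w').
rewrite (bigID (fun J : {set {set T}} => [forall e in J, #|e| == 2%N])) /=.
rewrite [X in _ + X]big1 ?addr0 => [|J /forall_inPn[e eJ e2]]; last first.
  by rewrite (bigD1 e) //= eJ /w (negbTE e2) mul0r.
rewrite (reindex_omap (@edges T) (insub : _ -> option (sgraph T))) /=.
  apply: eq_big => [G|G _]; first by rewrite (edges_card2 G) valK eqxx.
  rewrite big_mkcond; apply: eq_bigr => e _; rewrite /w /w'.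
  case: ifP => // e2; case: ifP => // eG.
  by have := forall_inP (edges_card2 G) e eG; rewrite e2.
by move=> J PJ; rewrite insubT.
Qed.

Lemma gnp_mass_ge0 {R : realType} {n : nat} {p : R} (G : sgraph 'I_n) :
  0 <= p <= 1 -> 0 <= gnp_mass p G.
Proof.
by move=> /andP[p0 p1]; apply: prodr_ge0 => e _; case: ifP; rewrite ?subr_ge0.
Qed.

Lemma sum_gnp_mass (R : realType) (n : nat) (p : R) :
  \sum_(G : sgraph 'I_n) gnp_mass p G = 1.
Proof.
rewrite (sum_sgraph (fun=> p) (fun=> 1 - p)).
by apply: big1 => e _; rewrite addrC subrK.
Qed.

Definition no_edge {T : finType} (G : sgraph T) (X Y : {set T}) : bool :=
  [forall x in X, forall y in Y, ~~ adj G x y].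

Lemma sum_no_edge {R : realType} {n : nat} {p : R} {X Y : {set 'I_n}} :
  0 <= p <= 1 -> [disjoint X & Y]%B ->
  \sum_(G : sgraph 'I_n | no_edge G X Y) gnp_mass p G <=
    (1 - p) ^+ (#|X| * #|Y|).
Proof.
move=> p01 dXY; have /andP[p0 p1] := p01.
pose F : {set {set 'I_n}} :=
  ((fun z => [set z.1; z.2]%SET) @: finset.setX X Y)%SET.
have xneqy x y : x \in X -> y \in Y -> x != y.
  move=> xX yY; apply: contraTneq yY => <-.
  by rewrite (disjointFr dXY).
have cF : #|F| = (#|X| * #|Y|)%N.
  rewrite card_in_imset ?cardsX // => -[x y] [x' y'] /=.
  rewrite !inE /= => /andP[xX yY] /andP[x'X y'Y] e.
  have : x \in [set x'; y']%SET by rewrite -e !inE eqxx.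
  rewrite !inE (negbTE (xneqy _ _ xX y'Y)) orbF => /eqP ->.
  have : y \in [set x'; y']%SET by rewrite -e !inE eqxx orbT.
  by rewrite !inE eq_sym (negbTE (xneqy _ _ x'X yY)) => /eqP ->.
have F2 e : e \in F -> #|e| == 2%N.
  move=> /imsetP[[x y]]; rewrite !inE /= => /andP[xX yY] ->.
  by rewrite cards2 xneqy.
(* Forbidding the pairs in [F] by weight 0 leaves the mass of graphs without [X]-[Y] edges
   unchanged, and the total then factorises: a pair in [F] gives [1 - p], any other gives 1. *)
pose u (e : {set 'I_n}) := if e \in F then 0 else p.
have u0 (G : sgraph 'I_n) : 0 <=
    \prod_(e : {set 'I_n} | #|e| == 2%N) (if e \in edges G then u e else 1 - p).
  by apply: prodr_ge0 => e _; case: ifP => _;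
    [rewrite /u; case: ifP | rewrite subr_ge0].
have -> : (1 - p) ^+ (#|X| * #|Y|) =
    \prod_(e : {set 'I_n} | #|e| == 2%N) (u e + (1 - p)).
  rewrite -cF -prodr_const big_mkcond [RHS]big_mkcond; apply: eq_bigr => e _.
  rewrite /u; case: ifP => [/F2 -> | _]; first by rewrite add0r.
  by case: ifP => // _; rewrite addrC subrK.
rewrite -(sum_sgraph u (fun=> 1 - p)) big_mkcond.
apply: ler_sum => G _; case: ifP => // /forall_inP noG.
rewrite le_eqVlt; apply/orP; left; apply/eqP; apply: eq_bigr => e _.
case: ifP => // eG; rewrite /u; case: ifP => // /imsetP[[x y]].
rewrite !inE /= => /andP[xX yY] exy.
by have := forall_inP (noG x xX) y yY; rewrite /adj -exy eG.
Qed.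

(** Union bound over the pairs [(X, Y)], of which there are at most [2^n * 2^n]. *)
Lemma sum_not_joined {R : realType} (n m : nat) {p : R} : 0 <= p <= 1 ->
  \sum_(G : sgraph 'I_n | ~~ joined G m) gnp_mass p G <=
    4 ^+ n * (1 - p) ^+ (m * m).
Proof.
move=> p01; have /andP[p0 p1] := p01.
pose Q (Z : {set 'I_n} * {set 'I_n}) :=
  [&& (m <= #|Z.1|)%N, (m <= #|Z.2|)%N & [disjoint Z.1 & Z.2]%B].
apply: (@le_trans _ _ (\sum_(Z | Q Z)
    \sum_(G : sgraph 'I_n | no_edge G Z.1 Z.2) gnp_mass p G)).
  rewrite (exchange_big_dep predT) //= big_mkcond; apply: ler_sum => G _.
  have mass0 := gnp_mass_ge0 G p01.
  case: ifP => [/forallPn[X /forallPn[Y]]|_]; last exact: sumr_ge0.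
  rewrite negb_imply => /andP[QXY /exists_inPn nXY].
  rewrite (bigD1 (X, Y)) /=; first by rewrite lerDl sumr_ge0.
  rewrite /Q QXY; apply/forall_inP => x /nXY /exists_inPn nY.
  by apply/forall_inP => y /nY.
apply: (@le_trans _ _ (\sum_(Z | Q Z) (1 - p) ^+ (m * m))).
  apply: ler_sum => -[X Y] /and3P[/= mX mY dXY].
  apply: le_trans (sum_no_edge p01 dXY) _.
  by apply: ler_wiXn2l; rewrite ?subr_ge0 ?gerBl ?leq_mul.
rewrite sumr_const -[leLHS]mulr_natl ler_wpM2r ?exprn_ge0 ?subr_ge0 //.
rewrite -natrX ler_nat; apply: leq_trans (max_card _) _.
by rewrite card_prod -cardsT -powersetT card_powerset cardsT card_ord -expnMn.
Qed.

Lemma gnp_prob_bounds {R : realType} {n m : nat} {p : R}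
    {A : set (sgraph 'I_n)} :
  0 <= p <= 1 -> (forall G, joined G m -> A G) ->
  1 - 4 ^+ n * (1 - p) ^+ (m * m) <= gnp_prob p A <= 1.
Proof.
move=> p01 joinA; apply/andP; split; last first.
  rewrite -(sum_gnp_mass R n p) /gnp_prob big_mkcond.
  by apply: ler_sum => G _; case: ifP => // _; exact: gnp_mass_ge0.
rewrite lerBlDr; apply: le_trans (lerD (lexx _) (sum_not_joined n m p01)).
rewrite -(sum_gnp_mass R n p) (bigID (fun G => joined G m)) /= lerD2r.
rewrite /gnp_prob big_mkcond [X in _ <= X]big_mkcond; apply: ler_sum => G _.
case: ifP => [/joinA AG|_]; first by rewrite mem_set.
by case: ifP => // _; exact: gnp_mass_ge0.
Qed.

(** * Choice of constants and the limit *)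

Lemma one_sub_expr_le {R : realType} {p : R} {k n : nat} :
  0 <= p <= 1 -> n%:R <= p * k%:R -> (1 - p) ^+ k <= 2^-1 ^+ n.
Proof.
move=> /andP[p0 p1] npk.
(* Both [1 - p <= e^(-p)] and [2 <= e] are instances of [1 + x <= e^x]. *)
apply: (@le_trans _ _ (expR (- p) ^+ k)).
  by apply: lerXn2r; rewrite ?nnegrE ?subr_ge0 ?expR_ge0 //; exact: expR_ge1Dx.
rewrite -expRM_natl; apply: (@le_trans _ _ (expR (n%:R * - 1))).
  by rewrite ler_expR; lra.
rewrite expRM_natl expRN; apply: lerXn2r;
  rewrite ?nnegrE ?invr_ge0 ?expR_ge0 //.
by rewrite lef_pV2 ?posrE ?expR_gt0 //; have := expR_ge1Dx (1 : R); lra.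
Qed.

Theorem theorem1p3 (R : realType) (eps : R) (heps : 0 < eps) :
  exists2 C : R, 0 <= C &
    (fun n : nat =>
       gnp_prob (C / n%:R)
         [set G : sgraph 'I_n |
           exists2 V' : {set 'I_n},
             (1 - eps) * n%:R <= #|V'|%:R :> R &
             globally_rigid R (induced_subgraph G V')])
      @ \oo --> (1 : R).
Proof.
(* For [m = n %/ q], having [q >= 2 / eps] keeps the [2m] deleted vertices within [eps * n], and
   [q >= 8] gives [8m <= n]. *)
pose q := (Num.bound (2 / eps)).+4.*2.
have q0 : 0 < q%:R :> R by rewrite ltr0n.
have epsq : 2 <= eps * q%:R.
  rewrite mulrC -ler_pdivrMr //.
  have := @archi_boundP R (2 / eps) (divr_ge0 (ler0n _ _) (ltW heps)).
  move=> /ltW /le_trans; apply; rewrite ler_nat /q; lia.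
(* Since [m >= n / (2q)], this makes [(c / n) * m^2 >= 4n]; the failure probability is then at most
   [4^n * 2^(-4n) = 4^(-n)]. *)
pose c := (16 * (q * q))%N; exists c%:R => //.
apply: (@squeeze_cvgr _ _ _ _ (fun n => 1 - 4^-1 ^+ n) (fun=> 1)); last 2 first.
- rewrite -[X in _ --> X]subr0; apply: cvgB; first exact: cvg_cst.
  by apply: cvg_expr; rewrite ger0_norm ?invf_lt1 ?ltr1n.
- exact: cvg_cst.
near=> n.
(* This ensures that [c / n] is a probability and that [m >= 1], so that rounding down at most
   halves [n / q]. *)
have cn : (c <= n)%N by near: n; exact: nbhs_infty_ge.
have n0 : 0 < n%:R :> R.
  by rewrite ltr0n; apply: leq_trans cn; rewrite /c /q; lia.
pose m := (n %/ q)%N.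
have mq : (m * q <= n)%N by exact: leq_trunc_div.
have nmq : (n <= 2 * (m * q))%N.
  have := ltn_ceil n (_ : 0 < q)%N; rewrite -/m.
  have : (1 <= m)%N by rewrite divn_gt0 // /c in cn *; nia.
  by nia.
have p01 : 0 <= (c%:R / n%:R : R) <= 1.
  by rewrite divr_ge0 //= ler_pdivrMr // mul1r ler_nat.
set A := (X in gnp_prob _ X).
have joinA G : joined G m -> A G.
  move=> joinG; have mn : (m * 8 <= #|'I_n|)%N.
    by rewrite card_ord; apply: leq_trans mq; rewrite leq_mul2l /q; lia.
  have [V cV rigV] := joined_rigid_subgraph R joinG mn; exists V => //.
  move: cV; rewrite card_ord -(ler_nat R) natrD -mul2n natrM => cV.
  have : m%:R * q%:R <= n%:R :> R by rewrite -natrM ler_nat.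
  nra.
have /andP[lowA ->] := gnp_prob_bounds p01 joinA; rewrite andbT.
apply: le_trans lowA; rewrite lerD2l lerN2.
have -> : 4^-1 ^+ n = 4 ^+ n * 2^-1 ^+ (4 * n) :> R.
  by rewrite exprM -exprMn; congr (_ ^+ n); lra.
rewrite ler_wpM2l ?exprn_ge0 //; apply: one_sub_expr_le => //.
rewrite mulrAC ler_pdivlMr // -!natrM ler_nat /c; nia.
Unshelve. all: by end_near.
Qed.
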